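(* Let $X_1, X_2, \ldots$ be i.i.d.\ with $\mathbb{P}\{X_1 = 2^k\} = 2^{-k}$, $k \in \mathbb{N}$. For $n \geq 1$ let $X_{1n} \geq \cdots \geq X_{nn}$ be the decreasing rearrangement of $X_1,\ldots,X_n$, $S_{n,r} = \sum_{k=r+1}^n X_{kn}$, and $\gamma_n = n/2^{\lceil \log_2 n\rceil}$. Fix an integer $r \geq 0$. There is a finite constant $C > 0$ such that for any $\delta \in (0,1)$, $x \geq e$ and $n \geq 1$, \[ \mathbb{P}\left\{ \frac{S_{n,r}}{n} - a^{(r)}_{n,\gamma_n} > x\right\} \leq \frac{2^{r+1}}{(r+1)!}\left[(1-\delta)x\right]^{-(r+1)} + C\, \delta^{-(r+3/2)} x^{-(r+3/2)}, \] where $a^{(r)}_{n,\gamma} = \sum_{j=r+1}^n \frac{\Psi(j/\gamma)}{j}$.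
   Context: $\Psi(x) = 2^{\{\log_2 x\}}$ for $x>0$, where $\{y\}$ is the fractional part of $y$. *)

(* Defs.v *)
From HB Require Import structures.
From mathcomp Require Import all_boot all_order all_algebra.
From mathcomp Require Import all_classical all_reals all_analysis.
Set Implicit Arguments. Unset Strict Implicit. Unset Printing Implicit Defensive.
Import Order.TTheory GRing.Theory Num.Theory.
Import numFieldNormedType.Exports.
Local Open Scope classical_set_scope.
Local Open Scope ring_scope.

Definition log2 {R : realType} (x : R) : R := ln x / ln 2.

Definition fracpart {R : realType} (y : R) : R := y - (Num.floor y)%:~R.

Definition Psi {R : realType} (x : R) : R := 2 `^ (fracpart (log2 x)).

(* gamma_n = n / 2^{ceil(log_2 n)}; ceil(log_2 n) = up_log 2 n
   (the smallest e with n <= 2^e). *)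
Definition gamma_n {R : realType} (n : nat) : R := n%:R / (2 ^+ up_log 2 n).

Definition a_rn {R : realType} (r n : nat) (g : R) : R :=
  \sum_(r.+1 <= j < n.+1) Psi (j%:R / g) / j%:R.

Definition trimmed_sum {R : realType} (r : nat) (s : seq R) : R :=
  \sum_(y <- drop r (sort (fun a b : R => b <= a) s)) y.

(* Mutual independence of a sequence of real random variables:
   for every n, the first n variables are independent (this is equivalent to
   independence of every finite subfamily, take B i = setT for unused i). *)
Definition mutually_independent {d} {T : measurableType d} {R : realType}
  (P : probability T R) (X : nat -> {RV P >-> R}) : Prop :=
  forall (n : nat) (B : nat -> set R), (forall i, measurable (B i)) ->
    P (\bigcap_(i in `I_n) (X i @^-1` B i)) =
    (\prod_(i < n) P (X i @^-1` B i))%E.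

Definition st_petersburg {d} {T : measurableType d} {R : realType}
  (P : probability T R) (Y : {RV P >-> R}) : Prop :=
  forall k : nat, (0 < k)%N -> P [set w | Y w = 2 ^+ k] = ((2 ^+ k)^-1)%:E.

Arguments mutually_independent {d T R} P X.
Arguments st_petersburg {d T R} P Y.

(* Main.v *)
(* Write y = delta x and t = (1 - delta) x n. Unless r + 1 of the X_i exceed t,
   which a union bound makes as unlikely as the main term, the event forces the
   sum with r + 1 maxima removed to exceed n (a + y). Truncate at a power 2 ^ M
   of order n y / (r + 2). Unless r + 2 of the X_i exceed 2 ^ M, which has
   probability O(y ^- (r + 2)), the sum T of the truncated variables exceeds
   n (a + y), whereas E T = n M with M <= a + O(y `^ (1/4)). Chernoff's bound with
   parameter lam = ln (y `^ (1/4)) / 2 ^ M then makes this O(y ^- (r + 2)) too, the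
   constant in the truncation level being chosen to get this exponent.
   Independence enters only through the finitely many cells on which each X_i has
   a given value 2 ^ k, k <= N, or none of them, so that all the estimates are
   about finite sums of products. *)
Require Import Defs.
From HB Require Import structures.
From mathcomp Require Import all_boot all_order all_algebra.
From mathcomp Require Import all_classical all_reals all_analysis.
From mathcomp Require Import ring lra zify.
Set Implicit Arguments. Unset Strict Implicit. Unset Printing Implicit Defensive.
Import Order.TTheory GRing.Theory Num.Theory.
Import numFieldNormedType.Exports.
Local Open Scope ring_scope.

(** * Finite products and order statistics *)

(** Union bound over the sets [J] of [m] indices. The weight [W J] forces marks on [J] only; summed
    over all [f] it factors, the free indices contributing 1 each. Every [f] with at least [m] marks
    is counted in full by some [J]. *)
Lemma sum_prod_le_card_marked (R : realFieldType) (K : finType) (p : K -> R)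
    (n m : nat) (b : pred K) :
  (forall k, 0 <= p k) -> \sum_k p k = 1 ->
  \sum_(f : {ffun 'I_n -> K} | (m <= #|[set i | b (f i)]|)%N)
     \prod_i p (f i)
  <= 'C(n, m)%:R * (\sum_(k | b k) p k) ^+ m.
Proof.
move=> p_ge0 p1.
pose W (J : {set 'I_n}) (f : {ffun 'I_n -> K}) :=
  \prod_i (if i \in J then p (f i) *+ b (f i) else p (f i)).
have W_ge0 J f : 0 <= W J f.
  by apply: prodr_ge0 => i _; case: ifP => _ //; rewrite mulrn_wge0.
have WE (J : {set _}) (f : {ffun _ -> _}) : J \subset [set i | b (f i)] -> W J f = \prod_i p (f i).
  move=> /fintype.subsetP Jb; apply: eq_bigr => i _; case: ifP => // /Jb.
  by rewrite inE => ->.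
have W_sum (J : {set _}) : #|J| = m -> \sum_f W J f = (\sum_(k | b k) p k) ^+ m.
  move=> Jm; rewrite -[LHS](bigA_distr_bigA (fun i k =>
    if i \in J then p k *+ b k else p k)).
  rewrite (bigID (mem J)) /= [X in _ * X]big1 ?mulr1; last first.
    by move=> i /negPf iJ; rewrite -[RHS]p1; apply: eq_bigr => k _; rewrite iJ.
  rewrite -Jm -prodr_const; apply: eq_bigr => i iJ.
  by rewrite [RHS]big_mkcond; apply: eq_bigr => k _; rewrite iJ mulrb.
have -> : 'C(n, m)%:R * (\sum_(k | b k) p k) ^+ m =
    \sum_f \sum_(J : {set 'I_n} | #|J| == m) W J f.
  rewrite exchange_big /= [RHS](eq_bigr (fun=> (\sum_(k | b k) p k) ^+ m)); last first.
    by move=> J /eqP; exact: W_sum.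
  rewrite sumr_const -[in LHS](card_ord n) -card_draws mulr_natl.
  by congr (_ *+ _); apply: eq_card => J; rewrite !inE.
rewrite big_mkcond /=; apply: ler_sum => f _; case: ifP => [mb|_]; last first.
  by apply: sumr_ge0.
have [s sb sm] : exists2 J : {set 'I_n}, J \subset [set i | b (f i)] & #|J| == m.
  have /card_geqP[s [us ss sB]] := mb; exists [set i in s].
    by apply/fintype.subsetP => i; rewrite inE => /sB.
  by rewrite cardsE (card_uniqP us) ss.
rewrite (bigD1 s) //= WE // lerDl; exact: sumr_ge0.
Qed.

(** Markov's inequality for the exponential of [lam] times the sum, whose total mass factors over
    the indices. *)
Lemma chernoff_sum_prod (R : realType) (K : finType) (p v : K -> R)
    (n : nat) (lam t : R) :
  (forall k, 0 <= p k) -> 0 <= lam ->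
  \sum_(f : {ffun 'I_n -> K} | t < \sum_i v (f i)) \prod_i p (f i)
  <= expR (- (lam * t)) * (\sum_k p k * expR (lam * v k)) ^+ n.
Proof.
move=> p_ge0 lam_ge0.
have -> : (\sum_k p k * expR (lam * v k)) ^+ n =
    \sum_(f : {ffun 'I_n -> K}) \prod_i (p (f i) * expR (lam * v (f i))).
  rewrite -[RHS](bigA_distr_bigA (fun (i : 'I_n) k => p k * expR (lam * v k))).
  by rewrite prodr_const card_ord.
rewrite mulr_sumr big_mkcond; apply: ler_sum => f _.
have p_prod : 0 <= \prod_i p (f i) by exact: prodr_ge0.
case: ifP => [tv|_]; last first.
  by rewrite mulr_ge0 ?expR_ge0 ?prodr_ge0 // => i _; rewrite mulr_ge0 ?expR_ge0.
rewrite big_split /= -expR_sum -mulr_sumr mulrCA ler_peMr // -expRD.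
rewrite -[leLHS]expR0 ler_expR addrC subr_ge0.
by rewrite ler_wpM2l // ltW.
Qed.

(** Among all ways of discarding a given number of terms, discarding the largest ones leaves the
    least sum. *)
Lemma sum_drop_le_sum_filter (R : numDomainType) (I : Type) (x : I -> R)
    (s : seq I) (q : pred I) :
  sorted (fun i j => x j <= x i) s ->
  \sum_(i <- drop (count (predC q) s) s) x i <= \sum_(i <- s | q i) x i.
Proof.
elim: s => [|i s IHs] /=; first by rewrite !big_nil.
move=> srt; have /IHs {}IHs := path_sorted srt.
rewrite big_cons; case: (q i) => /=; last by [].
rewrite add0n; case Ec : (count (predC q) s) => [|c] /=.
  by rewrite big_cons lerD2l; rewrite Ec drop0 in IHs.
have cs : (c < size s)%N by rewrite -Ec count_size.
(* The list shortened at its front still contains the entry of [s] at position [c], which the kept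
   head [x i] dominates; the induction hypothesis covers the rest. *)
rewrite (drop_nth i) // big_cons lerD //; last by rewrite -Ec.
have tr : transitive (fun i j : I => x j <= x i).
  by move=> a b e ab /le_trans; apply.
have /(all_nthP i) /(_ c cs) := order_path_min tr srt.
by [].
Qed.

(** * The centering sequence *)

Lemma exists_dyadic_level (R : realType) (u : R) : 1 <= u ->
  exists k : nat, 2 ^+ k <= u < 2 ^+ k.+1.
Proof.
move=> u1; have t0 : (0 < Num.trunc u)%N by rewrite truncn_gt0.
have /andP[lk uk] := trunc_log_bounds (isT : (1 < 2)%N) t0.
have /andP[lu uu] := truncn_itv (le_trans ler01 u1).
exists (trunc_log 2 (Num.trunc u)); rewrite -!natrX; apply/andP; split.
  by rewrite (le_trans _ lu) // ler_nat.
by rewrite (lt_le_trans uu) // ler_nat.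
Qed.

(** The floor of [log2 u] is [k], so [Psi u] is 2 to the power [log2 u - k]. *)
Lemma Psi_dyadic (R : realType) (u : R) (k : nat) :
  2 ^+ k <= u < 2 ^+ k.+1 -> Psi u = u / 2 ^+ k.
Proof.
move=> /andP[ku uk].
have u0 : 0 < u by rewrite (lt_le_trans _ ku) // exprn_gt0.
have ln2 : 0 < ln 2 :> R by rewrite ln_gt0 // ltr1n.
have log_ge : k%:R <= log2 u.
  by rewrite ler_pdivlMr // mulr_natl -lnXn // ler_ln ?posrE // exprn_gt0.
have log_lt : log2 u < k.+1%:R.
  by rewrite ltr_pdivrMr // mulr_natl -lnXn // ltr_ln ?posrE // exprn_gt0.
rewrite /Psi /fracpart (@floor_def _ _ k%:Z); last first.
  by rewrite -PoszD !pmulrn addn1 in log_ge log_lt *; rewrite log_ge log_lt.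
rewrite powRB ?pnatr_eq0 ?implybT // -pmulrn powR_mulrn //; congr (_ / _).
by rewrite /powR pnatr_eq0 /= /log2 divfK ?gt_eqF // lnK // posrE.
Qed.

(* The piecewise linear interpolation [G u = k + u / 2 ^ k - 1] of [log2]
   ([2 ^ k <= u < 2 ^ k.+1]) is concave with slope [Psi u / u], and
   [j |-> G (j / gamma_n n)] can be telescoped. *)
Lemma a_rn_ge (R : realType) (r n : nat) : (r < n)%N ->
  (up_log 2 n)%:R - 2 * r.+1%:R <= a_rn r n (gamma_n n) :> R.
Proof.
move=> rn; have n0 : (0 < n)%N by exact: leq_ltn_trans rn.
set E := up_log 2 n; set g : R := gamma_n n.
have nE : (n <= 2 ^ E)%N by exact: up_logP.
have nR : 0 < n%:R :> R by rewrite ltr0n.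
have gE : g^-1 = 2 ^+ E / n%:R by rewrite /g /gamma_n invf_div.
have g1 : 1 <= g^-1 by rewrite gE ler_pdivlMr // mul1r -natrX ler_nat.
have g2 : g^-1 <= 2.
  rewrite gE ler_pdivrMr // -natrX -natrM ler_nat /E.
  case: (ltnP 1 n) => [n1|]; last by case: n n0 {rn E g nE nR gE g1} => [|[|]].
  have /andP[up _] := up_log_bounds (isT : (1 < 2)%N) n1.
  have E0 : (0 < up_log 2 n)%N by rewrite up_log_gt0.
  by rewrite -(prednK E0) expnS leq_mul2l ltnW.
(* The index [j = 0] has no dyadic level and receives the dummy value 0. *)
have lev j : {k | (0 < j)%N -> 2 ^+ k <= j%:R * g^-1 < 2 ^+ k.+1}.
  apply: cid; case: (posnP j) => [->|j0]; first by exists 0%N.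
  have [|k kP] := @exists_dyadic_level R (j%:R * g^-1).
    by rewrite -[leLHS]mulr1 ler_pM // ler1n.
  by exists k.
pose k j := sval (lev j).
have kP j : (0 < j)%N -> 2 ^+ k j <= j%:R * g^-1 < 2 ^+ (k j).+1 := svalP (lev j).
pose G j : R := (k j)%:R + j%:R * g^-1 / 2 ^+ k j - 1.
(* Concavity: [G] lies below the extension of each of its earlier linear pieces. This reduces to
   [d + z <= z * 2 ^+ d] for [z >= 1], which follows from [d + 1 <= 2 ^+ d]. *)
have G_tangent i j : (0 < i)%N -> (0 < j)%N -> (k i <= k j)%N ->
    G j <= (k i)%:R + j%:R * g^-1 / 2 ^+ k i - 1.
  move=> i0 j0 /subnKC kij; rewrite /G lerD2r.
  have /andP[kj _] := kP j j0.
  have pi : (0:R) < 2 ^+ k i by exact: exprn_gt0.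
  set d := (k j - k i)%N in kij.
  rewrite -kij natrD exprD -addrA lerD2l.
  move: (j%:R * g^-1) kj => w kj.
  rewrite -kij exprD in kj.
  have pd : (0:R) < 2 ^+ d by exact: exprn_gt0.
  have d1 : d%:R + 1 <= 2 ^+ d :> R by rewrite natr1 -natrX ler_nat ltn_expl.
  have : 1 <= w / 2 ^+ k i / 2 ^+ d by rewrite 2?ler_pdivlMr // mul1r mulrC.
  set z := w / 2 ^+ k i / 2 ^+ d => z1.
  have -> : w / 2 ^+ k i = z * 2 ^+ d by rewrite divfK ?gt_eqF.
  have -> : w / (2 ^+ k i * 2 ^+ d) = z by rewrite /z -mulrA -invfM.
  by have := ler0n R d; nra.
have k_mono i : (0 < i)%N -> (k i <= k i.+1)%N.
  move=> i0; have /andP[ki _] := kP i i0; have /andP[_ ki1] := kP i.+1 isT.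
  have : 2 ^+ k i < 2 ^+ (k i.+1).+1 :> R.
    apply: le_lt_trans ki (le_lt_trans _ ki1).
    by rewrite ler_wpM2r ?ler_nat // (le_trans _ g1).
  by rewrite ltr_eXn2l ?ltr1n // ltnS.
have step j : (0 < j)%N -> G j.+1 - G j <= Psi (j%:R / g) / j%:R.
  move=> j0; rewrite (Psi_dyadic (kP j j0)).
  have := G_tangent j j.+1 j0 isT (k_mono j j0); rewrite /(G j) -natr1.
  have jR : j%:R != 0 :> R by rewrite pnatr_eq0 -lt0n.
  have -> : j%:R * g^-1 / 2 ^+ k j / j%:R = g^-1 / 2 ^+ k j.
    by rewrite -!mulrA mulrC -!mulrA mulVf // mulr1.
  by rewrite !mulrDl mul1r; lra.
(* At [j = n] the argument is exactly the dyadic point [2 ^+ E], where [G] agrees with [log2]. *)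
have Gn : G n = E%:R.
  have nu : n%:R * g^-1 = 2 ^+ E by rewrite gE mulrC divfK ?gt_eqF.
  have /andP[] := kP n n0; rewrite nu ler_eXn2l ?ltr1n // ltr_eXn2l ?ltr1n //.
  rewrite ltnS => kE Ek; have Ekn : k n = E by apply/eqP; rewrite eqn_leq kE.
  by rewrite /G nu Ekn divff ?addrK // expf_neq0 // pnatr_eq0.
(* Use the piece at [j = 1]: its level is at most 1 and its slope at most 2, since [g^-1] lies
   between 1 and 2. *)
have Gr : G r.+1 <= 2 * r.+1%:R.
  have k1 : (k 1%N <= k r.+1)%N by elim: r {rn} => // m IH; apply: leq_trans IH (k_mono _ _).
  have k10 : (k 1%N)%:R <= (1:R).
    have /andP[+ _] := kP 1%N isT; rewrite mul1r => /le_trans/(_ g2).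
    by rewrite -[leRHS]expr1 ler_eXn2l ?ltr1n // => ?; rewrite (ler_nat _ _ 1).
  have := G_tangent 1%N r.+1 isT isT k1.
  have : r.+1%:R * g^-1 / 2 ^+ k 1%N <= 2 * r.+1%:R.
    rewrite ler_pdivrMr ?exprn_gt0 //.
    have : (1:R) <= 2 ^+ k 1%N by rewrite exprn_ege1 // ler1n.
    have : (0:R) <= r.+1%:R by [].
    by nra.
  by lra.
have : \sum_(r.+1 <= j < n) (G j.+1 - G j) <= \sum_(r.+1 <= j < n) Psi (j%:R / g) / j%:R.
  rewrite !big_nat; apply: ler_sum => j /andP[rj _]; apply: step.
  exact: leq_trans rj.
rewrite telescope_sumr // Gn => Gsum.
(* The telescoped sum stops before [j = n]; the remaining term of [a_rn] is nonnegative and is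
   discarded. *)
rewrite /a_rn big_nat_recr //=.
have : 0 <= Psi (n%:R / g) / n%:R by rewrite divr_ge0 // powR_ge0.
by lra.
Qed.

(** * The trimmed sum *)

Local Open Scope classical_set_scope.

Lemma sorted_sort_eq (R : realDomainType) (I : Type) (x : I -> R) (s : seq I) :
  sorted (fun i j => x j <= x i) s ->
  sort (fun a b : R => b <= a) [seq x i | i <- s] = [seq x i | i <- s].
Proof.
move=> xs; apply: sorted_sort; last by rewrite sorted_map.
by move=> a b c ab /le_trans; apply.
Qed.

(** Ties do not matter: two sorted lists of the same values coincide. Hence indices may be sorted in
    place of values. *)
Lemma trimmed_sum_perm (R : realType) (I : eqType) (x : I -> R) (r : nat)
    (s t : seq I) :
  perm_eq s t -> sorted (fun i j => x j <= x i) t ->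
  trimmed_sum r [seq x i | i <- s] = \sum_(i <- drop r t) x i.
Proof.
move=> st xt; rewrite /trimmed_sum.
have /perm_sort_inP -> : perm_eq [seq x i | i <- s] [seq x i | i <- t].
  exact: perm_map.
- by rewrite sorted_sort_eq // -map_drop big_map.
- by move=> a b _ _; exact: le_total.
- by move=> a b c _ _ _ ab /le_trans; apply.
- by move=> a b _ _; rewrite andbC => /le_anti.
Qed.

Lemma trimmed_sum_le (R : realType) (n : nat) (x : 'I_n -> R) (A : {set 'I_n}) :
  trimmed_sum #|A| [seq x i | i <- enum 'I_n] <= \sum_(i | i \notin A) x i.
Proof.
pose leT i j := x j <= x i.
have srt : sorted leT (sort leT (enum 'I_n)).
  by apply: sort_sorted => i j; exact: le_total.
have pe : perm_eq (sort leT (enum 'I_n)) (enum 'I_n) by rewrite perm_sort.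
rewrite (@trimmed_sum_perm _ _ _ _ _ (sort leT (enum 'I_n))) //; last first.
  by rewrite perm_sym.
have := @sum_drop_le_sum_filter _ _ x _ (fun i => i \notin A) srt.
have /permP -> := pe.
rewrite (perm_big _ pe) /= big_enum_cond /=.
have -> : count (predC (fun i => i \notin A)) (enum 'I_n) = #|A|.
  rewrite cardE -size_filter; congr size; rewrite !enumT.
  by apply: eq_filter => i /=; rewrite negbK.
by [].
Qed.

(** The event is a finite union over the orderings [t] of [s]: for each, [t] sorts the values and
    the sum past its first [r] entries exceeds [c]. Both conditions compare measurable functions. *)
Lemma measurable_trimmed_sum (d : measure_display) (T : measurableType d)
    (R : realType) (I : choiceType) (x : I -> T -> R) (r : nat) (s : seq I) (c : R) :
  (forall i, measurable_fun setT (x i)) ->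
  measurable [set w | c < trimmed_sum r [seq x i w | i <- s]].
Proof.
move=> mx; pose leT w i j := x j w <= x i w.
have -> : [set w | c < trimmed_sum r [seq x i w | i <- s]] =
    \big[setU/set0]_(t <- permutations s)
      [set w | sorted (leT w) t && (c < \sum_(i <- drop r t) x i w)].
  apply/seteqP; split => w; rewrite -bigcup_seq /=.
    exists (sort (leT w) s) => /=.
      by rewrite mem_permutations perm_sort.
    have srt : sorted (leT w) (sort (leT w) s).
      by apply: sort_sorted => i j; exact: le_total.
    rewrite srt /= -(@trimmed_sum_perm _ _ (x^~ w) _ s) //.
    by rewrite perm_sym perm_sort.
  move=> [t /=]; rewrite mem_permutations => pt /andP[srt].
  by rewrite (@trimmed_sum_perm _ _ (x^~ w) _ s t) // perm_sym.
apply: bigsetU_measurable => t _.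
have mb (b : T -> bool) : measurable_fun setT b -> measurable [set w | b w].
  move=> mb; rewrite -[X in measurable X]setTI.
  exact: (mb measurableT [set true]).
apply: mb; apply: measurable_and.
  case: t => [|i t] /=; first exact: measurable_cst.
  elim: t i => [|j t IHt] i /=; first exact: measurable_cst.
  by apply: measurable_and => //; apply: measurable_realfun.measurable_fun_ler.
apply: measurable_realfun.measurable_fun_ltr; first exact: measurable_cst.
by apply: measurable_sum.
Qed.

(** * Cells *)

(* The value [2 ^ k] is coded by [k] for [1 <= k <= N]; the code [0] stands for all
   other values, and has the remaining mass [2 ^ - N]. *)
Definition cell (R : realType) {N : nat} (k : 'I_N.+1) : set R :=
  if k == ord0 then [set y | forall j, (0 < j <= N)%N -> y <> 2 ^+ j]
  else [set 2 ^+ k].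
Arguments cell R {N} k.

Definition cell_mass (R : realType) {N : nat} (k : 'I_N.+1) : R :=
  (2 ^+ (if k == ord0 then N else k))^-1.

Lemma cell_mass_ge0 (R : realType) (N : nat) (k : 'I_N.+1) : 0 <= cell_mass R k.
Proof. by rewrite invr_ge0 exprn_ge0. Qed.

(** The geometric sum from [m + 1] to [N] falls short of [2 ^- m] by [2 ^- N], precisely the mass of
    code 0. The tail is therefore exact, whatever [N] is. *)
Lemma sum_cell_mass_gt (R : realType) (N m : nat) : (m <= N)%N ->
  \sum_(k < N.+1 | (k == ord0) || (m < k)%N) cell_mass R k = (2 ^+ m)^-1.
Proof.
have tail : (m <= N)%N ->
    \sum_(k < N | (m < k.+1)%N) (2 ^+ k.+1)^-1 = (2 ^+ m)^-1 - (2 ^+ N)^-1 :> R.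
  elim: N => [|M IH]; first by rewrite leqn0 big_ord0 => /eqP ->; rewrite subrr.
  rewrite leq_eqVlt => /predU1P[->|].
    by rewrite subrr big_pred0 // => k; rewrite ltnS leqNgt ltn_ord.
  rewrite ltnS => mM; rewrite big_mkcond big_ord_recr /= -big_mkcond /= IH //.
  rewrite ltnS mM exprS invfM.
  by field; rewrite !expf_neq0.
move=> mN; rewrite big_mkcond big_ord_recl /= /cell_mass eqxx -big_mkcond.
rewrite (eq_bigl (fun k : 'I_N => (m < k.+1)%N)); last by [].
rewrite (eq_bigr (fun k : 'I_N => (2 ^+ k.+1)^-1)); last by [].
by rewrite tail // addrC subrK.
Qed.

Lemma sum_cell_mass (R : realType) (N : nat) : \sum_(k < N.+1) cell_mass R k = 1.
Proof.
rewrite -[RHS]invr1 -(expr0 2) -(@sum_cell_mass_gt R N 0) //.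
by apply: eq_bigl => k; rewrite -(inj_eq val_inj) /=; case: (k : nat).
Qed.

Lemma measurable_cell (R : realType) (N : nat) (k : 'I_N.+1) :
  measurable (cell R k).
Proof.
rewrite /cell; case: ifP => _ //.
rewrite (_ : [set y | _] = \big[setI/setT]_(j <- iota 1 N) ~` [set 2 ^+ j]).
  by apply: bigsetI_measurable => j _; apply: measurableC.
rewrite -bigcap_seq; apply/seteqP; split => y /= yN j.
  by move=> jN; apply: yN; rewrite /= mem_iota in jN; lia.
by move=> jN; apply: yN; rewrite /= mem_iota; lia.
Qed.

(** The law prescribes the atoms only; the cell of code 0 is the complement of [N] disjoint
    atoms. *)
Lemma prob_cell (d : measure_display) (T : measurableType d) (R : realType)
    (P : probability T R) (Y : {RV P >-> R}) (N : nat) (k : 'I_N.+1) :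
  st_petersburg P Y -> P (Y @^-1` cell R k) = (cell_mass R k)%:E.
Proof.
move=> PY; rewrite /cell /cell_mass; case: eqP => [_|/eqP k0]; last first.
  by rewrite -PY // lt0n; apply: contra k0 => /eqP k0; apply/eqP/val_inj.
pose F (j : nat) : set T := [set w | Y w = 2 ^+ j.+1].
have mF j : measurable (F j) by exact: (measurable_funPTI Y (measurable_set1 _)).
have -> : Y @^-1` [set y | forall j, (0 < j <= N)%N -> y <> 2 ^+ j] =
    ~` \big[setU/set0]_(j < N) F j.
  rewrite -(bigcup_mkord N F); apply/seteqP; split => w /=.
    by move=> YN [j /= jN]; apply: YN.
  by move=> YN [|j] // jN Yj; apply: YN; exists j.
rewrite probability_setC; last exact: bigsetU_measurable.
rewrite measure_bigsetU //; last first.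
  move=> i j _ _ [w [Yi Yj]]; apply/succn_inj/(@ieexprIn R 2) => //.
    by rewrite gt_eqF // ltr1n.
  by rewrite -Yi -Yj.
rewrite (eq_bigr (fun j : 'I_N => ((2 ^+ j.+1)^-1)%:E)); last by move=> j _; exact: PY.
rewrite sumEFin -EFinB; congr _%:E.
have := sum_cell_mass R N; rewrite big_ord_recl /cell_mass eqxx.
rewrite (eq_bigr (fun k : 'I_N => (2 ^+ k.+1)^-1)); last by [].
by move=> mass1; apply/eqP; rewrite subr_eq mass1.
Qed.

(* [E] needs to be measurable: [P] is unconstrained on other sets. *)
Lemma prob_le_sum_cells (d : measure_display) (T : measurableType d)
    (R : realType) (P : probability T R) (X : nat -> {RV P >-> R}) (n N : nat)
    (E : set T) (Q : pred {ffun 'I_n -> 'I_N.+1}) :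
  mutually_independent P X -> (forall i, st_petersburg P (X i)) ->
  measurable E ->
  (forall w (f : {ffun 'I_n -> 'I_N.+1}), E w -> (forall i, cell R (f i) (X i w)) ->
    Q f) ->
  (P E <= (\sum_(f : {ffun _} | Q f) \prod_i cell_mass R (f i))%:E)%E.
Proof.
move=> indX PX mE EQ.
(* Independence takes a set for every natural index, so the cells are continued by [setT] from [n]
   on. *)
pose B (f : {ffun 'I_n -> 'I_N.+1}) (i : nat) : set R :=
  if insub i is Some j then cell R (f j) else setT.
have mB f i : measurable (B f i).
  by rewrite /B; case: insub => // j; exact: measurable_cell.
have BE f (i : 'I_n) : B f i = cell R (f i) by rewrite /B valK.
pose C f := \bigcap_(i in `I_n) (X i @^-1` B f i).
have mC f : measurable (C f).
  by apply: bigcap_measurableType => i _; apply: measurable_funPTI.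
have PC f : P (C f) = (\prod_i cell_mass R (f i))%:E.
  rewrite indX // -prodEFin; apply: eq_bigr => i _.
  by rewrite BE prob_cell.
have EC : E `<=` \big[setU/set0]_(f <- enum Q) C f.
  move=> w Ew; rewrite -bigcup_seq /=.
  have cov i : {k : 'I_N.+1 | cell R k (X i w)}.
    apply: cid; rewrite /cell; have [[j jN Xj]|XN] := pselect
      (exists2 j : nat, (0 < j <= N)%N & X i w = 2 ^+ j).
      have jN' : (j < N.+1)%N by lia.
      exists (Ordinal jN'); rewrite ifF //=.
      by apply/negP => /eqP[] j0; rewrite j0 in jN.
    by exists ord0; rewrite eqxx /= => j jN Xj; apply: XN; exists j.
  pose f := [ffun i : 'I_n => sval (cov i)].
  have fP i : cell R (f i) (X i w) by rewrite ffunE; exact: (svalP (cov i)).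
  exists f; first by rewrite /= mem_enum; exact: EQ fP.
  move=> i /= iN; rewrite /= -[i]/(val (Ordinal iN)) BE; exact: fP.
apply: (@le_trans _ _ (P (\big[setU/set0]_(f <- enum Q) C f))).
  by apply: le_measure; rewrite ?inE //; exact: bigsetU_measurable.
rewrite -sumEFin -big_enum /=.
elim: (enum Q) => [|f s IHs]; first by rewrite !big_nil measure0.
rewrite !big_cons -PC; apply: le_trans (leeD2l _ IHs).
apply: measureU2 => //; exact: bigsetU_measurable.
Qed.

(** * Truncation *)

Lemma bin_le_expn_div_fact (R : realFieldType) (n m : nat) :
  'C(n, m)%:R <= n%:R ^+ m / m`!%:R :> R.
Proof.
rewrite ler_pdivlMr ?ltr0n ?fact_gt0 // -natrM bin_ffact -natrX ler_nat.
elim: m => [|m IHm]; first by rewrite ffactn0 expn0.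
by rewrite ffactnSr expnSr leq_mul // leq_subr.
Qed.

(** From [1 - u <= expR (- u)] comes [expR u - 1 <= u * expR u]; applying this twice gives the
    quadratic remainder. *)
Lemma expR_le_quadratic (R : realType) (u K : R) : 0 <= u <= K ->
  expR u <= 1 + u + u ^+ 2 * expR K.
Proof.
move=> /andP[u0 uK]; have euK : expR u <= expR K by rewrite ler_expR.
have e1 : 1 <= expR u by rewrite -expR0 ler_expR.
have eu : expR u - 1 <= u * expR u.
  have := ler_wpM2r (expR_ge0 u) (expR_ge1Dx (- u)).
  by rewrite [X in _ <= X]mulrC expRxMexpNx_1; lra.
suff : u * (expR u - 1) <= u ^+ 2 * expR K by lra.
rewrite expr2 -mulrA ler_wpM2l // (le_trans eu) // ler_wpM2l //.
Qed.

(** This acts on codes: code 0, whose value is unknown, counts as zero just like the codes above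
    [M]. *)
Definition truncated_value (R : realType) (M k : nat) : R :=
  if (0 < k <= M)%N then 2 ^+ k else 0.

Lemma truncated_value_ge0 (R : realType) (M k : nat) : 0 <= truncated_value R M k.
Proof. by rewrite /truncated_value; case: ifP => // _; exact: exprn_ge0. Qed.

Lemma sum_level (R : realType) (N M : nat) (F : nat -> R) : (M <= N)%N ->
  \sum_(k < N.+1) (if (0 < k <= M)%N then F k else 0) = \sum_(k < M) F k.+1.
Proof.
move=> MN; rewrite big_ord_recl add0r.
rewrite -(big_mkord xpredT (fun k => F k.+1)) (big_nat_widen _ _ _ _ _ MN).
by rewrite big_mkord [RHS]big_mkcond.
Qed.

(** Expand the exponential to second order. Each level [k <= M] adds [2 ^- k * 2 ^+ k = 1] to the
    mean, which is thus [M]; the second moment is below [2 * 2 ^+ M], and [lam * 2 ^+ M = K] absorbs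
    one factor [lam]. *)
Lemma truncated_mgf_le (R : realType) (N M : nat) (lam K : R) :
  (M <= N)%N -> 0 <= lam -> lam * 2 ^+ M = K ->
  \sum_(k < N.+1) cell_mass R k * expR (lam * truncated_value R M k)
  <= 1 + lam * (M%:R + 2 * K * expR K).
Proof.
move=> MN lam0 lamK.
have term (k : 'I_N.+1) :
    cell_mass R k * expR (lam * truncated_value R M k) <= cell_mass R k +
      (lam * (if (0 < k <= M)%N then 1 else 0) +
       lam ^+ 2 * expR K * (if (0 < k <= M)%N then 2 ^+ k else 0)).
  rewrite /truncated_value; case: ifP => [/andP[k0 kM]|_]; last first.
    by rewrite !mulr0 expR0 mulr1 !addr0.
  have kn0 : (k == ord0) = false by apply/eqP => k1; rewrite k1 in k0.
  have p0 : (0:R) < 2 ^+ k by exact: exprn_gt0.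
  have /expR_le_quadratic : 0 <= lam * 2 ^+ k <= K.
    apply/andP; split; first by rewrite mulr_ge0 // ltW.
    by rewrite -lamK ler_wpM2l // ler_eXn2l // ltr1n.
  rewrite /cell_mass kn0 => le_q; rewrite mulrC ler_pdivrMr //.
  apply: le_trans le_q _; rewrite le_eqVlt; apply/orP; left; apply/eqP.
  by field; rewrite gt_eqF.
apply: le_trans (ler_sum _ (fun k _ => term k)) _.
rewrite big_split /= sum_cell_mass lerD2l big_split /= -!mulr_sumr.
rewrite (sum_level (fun=> 1) MN) (sum_level (fun k => 2 ^+ k) MN).
rewrite sumr_const card_ord mulrDr lerD2l.
have -> : \sum_(k < M) 2 ^+ k.+1 = 2 * (2 ^+ M - 1) :> R.
  have -> : 2 ^+ M - 1 = \sum_(k < M) 2 ^+ k :> R by rewrite subrX1; lra.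
  by rewrite mulr_sumr; apply: eq_bigr => k _; rewrite exprS.
rewrite -lamK; have := expR_ge0 (lam * 2 ^+ M).
move: (expR _) => e e0.
have := mulr_ge0 (mulr_ge0 lam0 lam0) e0; nra.
Qed.

Lemma exists_superset_card (I : finType) (B : {set I}) (r : nat) :
  (#|B| <= r <= #|I|)%N -> exists2 A : {set I}, B \subset A & #|A| = r.
Proof.
move=> /andP[Br rI].
have : (r - #|B| <= #|finset.setC B|)%N by rewrite [leqRHS]cardsCs finset.setCK leq_sub2r.
move=> /card_geqP[s [us ss sB]]; exists (B :|: [set i in s])%SET.
  exact: finset.subsetUl.
rewrite cardsU cardsE (card_uniqP us) ss.
rewrite (_ : (B :&: _)%SET = finset.set0) ?cards0 ?subn0 ?subnKC //.
apply/finset.setP => i; rewrite !inE; apply/negP => /andP[iB /sB].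
by rewrite inE iB.
Qed.

(** Remove a set [C] of [r] indices that contains [A] and all of [B] except at most one index. That
    index lies outside [A], so it costs at most [t]; every other remaining index is outside [B]. *)
Lemma trimmed_sum_le_two_levels (R : realType) (r n : nat) (x : 'I_n -> R)
    (A B : {set 'I_n}) (t : R) :
  (r <= n)%N -> (#|A| <= r)%N -> (#|B| <= r.+1)%N ->
  (A \subset B) || (B \subset A) -> 0 <= t ->
  (forall i, i \notin A -> x i <= t) -> (forall i, i \notin B -> 0 <= x i) ->
  trimmed_sum r [seq x i | i <- enum 'I_n] <= t + \sum_(i | i \notin B) x i.
Proof.
move=> rn Ar Br AB t0 xA xB.
have [C [Cr AC [D BC]]] : exists C : {set 'I_n}, [/\ #|C| = r, A \subset C &
    exists D : option 'I_n, forall i, i \notin C -> i \in B -> D = Some i].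
  have ext (B' : {set 'I_n}) : (#|B'| <= r)%N -> A \subset B' -> B \subset B' ->
      exists C : {set 'I_n}, [/\ #|C| = r, A \subset C &
      exists D : option 'I_n, forall i, i \notin C -> i \in B -> D = Some i].
    move=> B'r AB' BB'; have [|C B'C Cr] := @exists_superset_card _ B' r.
      by rewrite B'r card_ord.
    exists C; split => //; first exact: fintype.subset_trans B'C.
    exists None => i iC iB; case/negP: iC.
    exact: (fintype.subsetP (fintype.subset_trans BB' B'C)).
  case/orP: AB => [AB|BA]; last exact: (ext A).
  case: (leqP #|B| r) => [Br'|rB]; first exact: (ext B).
  have /subsetPn[i iB iA] : ~~ (B \subset A).
    by apply: contraL rB => /subset_leq_card BA; rewrite -leqNgt (leq_trans BA).
  (* Here [B] has exactly [r + 1] elements, and the index left over is chosen in [B] outside [A]. *)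
  exists (B :\ i)%SET; split.
  - by apply/eqP; rewrite -eqSS -add1n -[1%N]/(nat_of_bool true) -iB -cardsD1 eqn_leq Br rB.
  - by rewrite subsetD1 AB.
  - exists (Some i) => j; rewrite !inE negb_and negbK.
    by move=> /orP[/eqP -> //|/negP].
rewrite -Cr; apply: le_trans (trimmed_sum_le _ _) _.
rewrite (bigID (mem B)) /=; apply: lerD.
  case: D BC => [i|] BC.
    apply: (@le_trans _ _ (\sum_(j | j == i) t)).
      rewrite big_mkcond [leRHS]big_mkcond; apply: ler_sum => j _ /=.
      case: ifP => [/andP[jC jB]|_]; last by case: ifP.
      have [ij] := BC j jC jB; rewrite ij eqxx xA //.
      by apply: contra jC; exact: (fintype.subsetP AC).
    by rewrite big_pred1_eq.
  by rewrite big_pred0 // => j; apply/negP => /andP[jC /(BC j jC)].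
rewrite big_mkcond [leRHS]big_mkcond; apply: ler_sum => j _ /=.
case: (boolP (j \in B)) => jB; first by rewrite andbF.
by rewrite andbT; case: ifP => // _; exact: xB.
Qed.

(** The three terms bound three events on codes: [r + 1] codes beyond [k], [r + 2] codes beyond [M],
    or a truncated sum above [s]. If none occurs, the two-level comparison bounds the trimmed sum by
    [s + t]. For [k = 0] every code counts as beyond [k], so no condition on [t] arises from it. *)
Lemma prob_trimmed_sum_le (d : measure_display) (T : measurableType d)
    (R : realType) (P : probability T R) (X : nat -> {RV P >-> R})
    (r n k M : nat) (s t lam K : R) :
  mutually_independent P X -> (forall i, st_petersburg P (X i)) ->
  (r < n)%N -> 0 <= t -> (0 < k)%N ==> (2 ^+ k <= t) ->
  0 <= lam -> lam * 2 ^+ M = K ->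
  (P [set w | (s + t < trimmed_sum r [seq X i w | i <- iota 0 n])%R] <=
   ('C(n, r.+1)%:R * (2 ^- k) ^+ r.+1 + 'C(n, r.+2)%:R * (2 ^- M) ^+ r.+2
    + expR (- (lam * s)) * (1 + lam * (M%:R + 2 * K * expR K)) ^+ n)%:E)%E.
Proof.
move=> indX PX rn t0 kt lam0 lamK.
pose N := maxn k M.
have kN : (k <= N)%N by exact: leq_maxl.
have MN : (M <= N)%N by exact: leq_maxr.
pose above (m : nat) (j : 'I_N.+1) := (j == ord0) || (m < j)%N.
pose tail m (f : {ffun 'I_n -> 'I_N.+1}) := [set i | above m (f i)]%SET.
pose v (j : 'I_N.+1) := truncated_value R M j.
pose Q (f : {ffun 'I_n -> 'I_N.+1}) :=
  [|| (r.+1 <= #|tail k f|)%N, (r.+2 <= #|tail M f|)%N | s < \sum_i v (f i)].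
have iotaE w : [seq X i w | i <- iota 0 n] = [seq X (val i) w | i <- enum 'I_n].
  by rewrite -val_enum_ord -map_comp.
have mX i : measurable_fun setT (X i) by [].
apply: (le_trans (@prob_le_sum_cells _ _ _ P X n N _ Q indX PX _ _)).
- exact: (@measurable_trimmed_sum d T R nat (fun i => X i) r (iota 0 n) (s + t) mX).
- move=> w f /= Ew fX; rewrite /Q; apply/or3P.
  case: (ltnP r #|tail k f|) => [|kr]; first by constructor 1.
  case: (ltnP r.+1 #|tail M f|) => [|Mr]; first by constructor 2.
  constructor 3; rewrite -(ltrD2r t) (lt_le_trans Ew) // iotaE addrC.
  have val_cell m i : i \notin tail m f -> X i w = 2 ^+ f i /\ (0 < f i <= m)%N.
    rewrite inE negb_or -leqNgt => /andP[f0 fm]; have := fX i.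
    rewrite /cell (negPf f0) => ->; split => //.
    by rewrite fm andbT lt0n; apply: contra f0 => /eqP f0; apply/eqP/val_inj.
  have tailS m m' : (m <= m')%N -> tail m' f \subset tail m f.
    move=> mm'; apply/fintype.subsetP => i; rewrite !inE /above => /orP[->//|].
    by move=> /(leq_ltn_trans mm') ->; rewrite orbT.
  have -> : \sum_i v (f i) = \sum_(i | i \notin tail M f) X i w.
    rewrite [RHS]big_mkcond; apply: eq_bigr => i _; rewrite /v /truncated_value.
    case: (boolP (i \notin tail M f)) => [iM|]; first by have [-> ->] := val_cell _ _ iM.
    rewrite negbK inE /above => fM.
    rewrite ifF //; case/orP: fM => [/eqP fi0|fM]; first by rewrite fi0.
    by rewrite [(_ <= M)%N]leqNgt fM andbF.
  apply: (@trimmed_sum_le_two_levels _ r n (fun i : 'I_n => X i w) (tail k f)) => //.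
  + exact: ltnW.
  (* The two exceptional sets are nested in the order opposite to their levels. *)
  + by case: (leqP k M) => [/tailS ->|/ltnW/tailS ->]; rewrite ?orbT.
  + move=> i ik; have [-> /andP[f0 fk]] := val_cell _ _ ik; have k0 := leq_trans f0 fk.
    by rewrite k0 /= in kt; apply: le_trans kt; rewrite ler_eXn2l // ltr1n.
  + by move=> i iM; have [-> _] := val_cell _ _ iM; exact: exprn_ge0.
pose mass (f : {ffun 'I_n -> 'I_N.+1}) := \prod_i cell_mass R (f i).
have mass0 f : 0 <= mass f by apply: prodr_ge0 => i _; exact: cell_mass_ge0.
have union (Q1 Q2 : pred {ffun 'I_n -> 'I_N.+1}) :
    \sum_(f | Q1 f || Q2 f) mass f <= \sum_(f | Q1 f) mass f + \sum_(f | Q2 f) mass f.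
  rewrite big_mkcond [X in _ <= X + _]big_mkcond [X in _ <= _ + X]big_mkcond.
  rewrite -big_split; apply: ler_sum => f _ /=.
  by have := mass0 f; case: (Q1 f); case: (Q2 f) => /=; lra.
have mass1 := sum_cell_mass R N.
rewrite lee_fin /Q -addrA; apply: le_trans (union _ _) _; apply: lerD.
  rewrite -(sum_cell_mass_gt R kN).
  exact: (sum_prod_le_card_marked _ _ _ (@cell_mass_ge0 R N) mass1).
apply: le_trans (union _ _) _; apply: lerD.
  rewrite -(sum_cell_mass_gt R MN).
  exact: (sum_prod_le_card_marked _ _ _ (@cell_mass_ge0 R N) mass1).
apply: le_trans (chernoff_sum_prod _ _ _ (@cell_mass_ge0 _ _) lam0) _.
rewrite ler_wpM2l ?expR_ge0 //; apply: lerXn2r; rewrite ?nnegrE.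
- by apply: sumr_ge0 => j _; rewrite mulr_ge0 ?cell_mass_ge0 ?expR_ge0.
- have : 0 <= K by rewrite -lamK mulr_ge0 // exprn_ge0.
  by move=> K0; rewrite addr_ge0 // mulr_ge0 // addr_ge0 // !mulr_ge0 // expR_ge0.
- exact: truncated_mgf_le.
Qed.

(** Take logarithms, with [ln u <= u] and [ln 2 >= 1 / 2]. *)
Lemma level_le (R : realType) (E M : nat) (u : R) :
  1 <= u -> 2 ^+ M <= 2 ^+ E * u ^+ 4 -> M%:R <= E%:R + 8 * u.
Proof.
move=> u1 ME; have u0 : 0 < u by lra.
have ln2 : 1 / 2 <= ln 2 :> R.
  rewrite -ler_expR lnK ?posrE //.
  have := ler_wpM2r (expR_ge0 (1 / 2 : R)) (expR_ge1Dx (- (1 / 2 : R))).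
  by rewrite [X in _ <= X]mulrC expRxMexpNx_1; lra.
have lnu : ln u <= u by rewrite ltW // ln_sublinear.
have : ln (2 ^+ M) <= ln (2 ^+ E * u ^+ 4).
  by rewrite ler_ln // posrE ?mulr_gt0 ?exprn_gt0.
rewrite lnM ?posrE ?exprn_gt0 // !lnXn // -![ln _ *+ _]mulr_natl => H.
case: (leP M%:R (E%:R : R)) => [|EM]; first by lra.
have : (M%:R - E%:R) * ln 2 <= 4 * u by lra.
nra.
Qed.

(** By [1 + v <= expR v] the exponent is at most [lam * n * (m - a - u ^+ 4)]. Since
    [m - a <= u ^+ 4 / 2], it is at most [- ln u * (n * u ^+ 4 / 2 ^+ M) / 2], and the factor
    [8 * c] in the truncation level turns this into [- 4 * c * ln u]. *)
Lemma truncated_chernoff_le (R : realType) (c n M E : nat) (a u : R) :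
  (0 < n)%N -> (n <= 2 ^ E)%N -> (1 < c)%N -> 2 * c%:R <= u ->
  E%:R - 2 * c%:R <= a ->
  2 ^+ M <= n%:R * u ^+ 4 / (8 * c%:R) ->
  expR (- (ln u / 2 ^+ M * (n%:R * (a + u ^+ 4)))) *
    (1 + ln u / 2 ^+ M * (M%:R + 2 * ln u * expR (ln u))) ^+ n
  <= (u ^+ 4) ^- c.
Proof.
move=> n0 nE c1 cu aE ML.
have c2 : 2 <= c%:R :> R by rewrite (ler_nat _ 2).
have u4 : 4 <= u by lra.
have u0 : 0 < u by lra.
have lnu0 : 0 <= ln u by rewrite ln_ge0 //; lra.
have lnu : ln u <= u by rewrite ltW // ln_sublinear.
have p0 : (0 : R) < 2 ^+ M by exact: exprn_gt0.
have nR : 0 < n%:R :> R by rewrite ltr0n.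
have w0 : 0 < u ^+ 4 by exact: exprn_gt0.
have ME : M%:R <= E%:R + 8 * u.
  apply: level_le; first by lra.
  apply: (le_trans ML); rewrite ler_pdivrMr; last by lra.
  rewrite -[leLHS]mulr1; apply: ler_pM => //; [by rewrite mulr_ge0 // ltW| |lra].
  by rewrite ler_wpM2r ?(ltW w0) // -natrX ler_nat.
rewrite lnK ?posrE //.
set lam := ln u / 2 ^+ M; set m := M%:R + _.
have lam0 : 0 <= lam by rewrite divr_ge0 // ltW.
(* The excess [m - a] is at most [8 * u + 2 * c + 2 * u * ln u], of order [u ^+ 2]; [u >= 4] makes
   half of [u ^+ 4] dominate it. *)
have m_le : m - a <= u ^+ 4 / 2.
  have : 2 * ln u * u <= 2 * u ^+ 2 by rewrite expr2; nra.
  have : 16 * u ^+ 2 <= u ^+ 4.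
    have : 16 <= u ^+ 2 by rewrite expr2; nra.
    by rewrite (exprD u 2 2) => ?; rewrite ler_wpM2r // exprn_ge0 // ltW.
  have : 4 * u <= u ^+ 2 by rewrite expr2 ler_wpM2r // (ltW u0).
  by rewrite /m; lra.
have m0 : 0 <= m by rewrite addr_ge0 // !mulr_ge0 // ltW.
have : (1 + lam * m) ^+ n <= expR (lam * m) ^+ n.
  apply: lerXn2r; rewrite ?nnegrE ?expR_ge0 ?expR_ge1Dx //.
  by rewrite addr_ge0 // mulr_ge0.
rewrite -expRM_natl => /(ler_wpM2l (expR_ge0 (- (lam * (n%:R * (a + u ^+ 4)))))).
move=> /le_trans; apply; rewrite -expRD.
rewrite -exprM -[X in X ^- _](@lnK _ u) ?posrE // -expRM_natl -expRN ler_expR.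
have nM : 8 * c%:R <= n%:R * u ^+ 4 / 2 ^+ M.
  by rewrite ler_pdivlMr // -ler_pdivlMl ?(mulrC (_^-1)); lra.
have : lam * n%:R * (m - a) <= lam * n%:R * (u ^+ 4 / 2).
  by rewrite ler_wpM2l // mulr_ge0 // (ltW nR).
have -> : lam * n%:R * (u ^+ 4 / 2) = ln u * (n%:R * u ^+ 4 / 2 ^+ M) / 2.
  by rewrite /lam; field; rewrite gt_eqF.
have := ler_wpM2l lnu0 nM.
have -> : - (lam * (n%:R * (a + u ^+ 4))) + n%:R * (lam * m) =
   lam * n%:R * (m - a) - ln u * (n%:R * u ^+ 4 / 2 ^+ M).
  by rewrite /lam; field; rewrite gt_eqF.
rewrite natrM; lra.
Qed.

(** * The tail bound *)

(** Take for [k] the dyadic level of [q * n], or 0 if [q * n < 1]. Then [n / 2 ^+ k <= 2 / q]: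
    rounding down to a power of 2 is the source of the factor [2 ^+ r.+1]. *)
Lemma main_term_le (R : realType) (r n : nat) (q : R) :
  (0 < n)%N -> 0 < q -> exists k : nat,
  ((0 < k)%N ==> (2 ^+ k <= q * n%:R)) /\
  'C(n, r.+1)%:R * (2 ^- k) ^+ r.+1 <= 2 ^+ r.+1 / r.+1`!%:R * q ^- r.+1.
Proof.
move=> n0 q0; have nR : 0 < n%:R :> R by rewrite ltr0n.
have qn : 0 < q * n%:R by exact: mulr_gt0.
have [k [kq qk]] : exists k : nat,
    ((0 < k)%N ==> (2 ^+ k <= q * n%:R)) /\ q * n%:R < 2 ^+ k.+1.
  case: (leP 1 (q * n%:R)) => [/exists_dyadic_level[k /andP[kq qk]]|qn1].
    by exists k; rewrite kq implybT.
  by exists 0%N; rewrite expr1; split => //; lra.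
exists k; split=> //.
have p0 : (0 : R) < 2 ^+ k by exact: exprn_gt0.
apply: le_trans (ler_wpM2r _ (bin_le_expn_div_fact R n r.+1)) _.
  by rewrite exprn_ge0 // invr_ge0 ltW.
have -> : n%:R ^+ r.+1 / r.+1`!%:R * (2 ^- k) ^+ r.+1 =
    (n%:R / 2 ^+ k) ^+ r.+1 / r.+1`!%:R :> R by rewrite exprMn mulrAC.
have -> : 2 ^+ r.+1 / r.+1`!%:R * q ^- r.+1 = (2 / q) ^+ r.+1 / r.+1`!%:R :> R.
  by rewrite exprMn exprVn mulrAC.
rewrite ler_wpM2r ?invr_ge0 //; apply: lerXn2r.
- by rewrite nnegrE divr_ge0 // ltW.
- by rewrite nnegrE divr_ge0 // ltW.
rewrite ler_pdivrMr // mulrAC ler_pdivlMr // mulrC -exprS.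
exact: ltW.
Qed.

Lemma powRN_exprn_le (R : realType) (m : nat) (e y : R) :
  1 <= y -> e <= m%:R -> y ^- m <= y `^ (- e).
Proof.
move=> y1 em; have y0 : 0 < y by lra.
by rewrite -powR_invn ?(ltW y0) //; apply: ler_powR; rewrite ?lerN2.
Qed.

(** For [y] up to the threshold [z], this makes the error term at least 1 and the tail bound
    trivial. *)
Lemma one_le_powRN (R : realType) (m : nat) (e y z : R) :
  1 <= z -> 0 <= e <= m%:R -> 0 < y <= z -> 1 <= z ^+ m * y `^ (- e).
Proof.
move=> z1 /andP[e0 em] /andP[y0 yz]; have z0 : 0 < z by lra.
rewrite powRN ler_pdivlMr ?powR_gt0 // mul1r.
apply: (@le_trans _ _ (z `^ e)).
  by apply: ge0_ler_powR; rewrite ?nnegrE // ltW.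
by rewrite -powR_mulrn ?(ltW z0) //; apply: ler_powR.
Qed.

(* X_1, X_2, ... are X 0, X 1, ...; the sample X_1..X_n is [X 0 w; ...; X (n-1) w]. *)
Theorem theorem4 (d : measure_display) (T : measurableType d) (R : realType)
  (P : probability T R) (X : nat -> {RV P >-> R}) :
  mutually_independent P X ->
  (forall i, st_petersburg P (X i)) ->
  forall r : nat, exists C : R, 0 < C /\
    forall (delta x : R) (n : nat),
      0 < delta < 1 -> expR 1 <= x -> (0 < n)%N ->
      (P [set w | (trimmed_sum r [seq X i w | i <- iota 0 n] / n%:R
                   - a_rn r n (gamma_n n) > x)%R]
      <= ((2 ^+ r.+1 / (r.+1)`!%:R) * ((1 - delta) * x) ^- r.+1
          + C * delta `^ (- (r%:R + 3/2)) * x `^ (- (r%:R + 3/2)))%:E)%E.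
Proof.
move=> indX PX r.
pose c : R := r.+2%:R; pose e : R := r%:R + 3 / 2.
have c2 : 2 <= c by rewrite /c (ler_nat _ 2).
have ec : 0 <= e <= c.
  by rewrite /e /c -addn2 natrD; have := ler0n R r; lra.
(* Beyond this threshold the fourth root [u] of [y] is at least [2 * c], as the Chernoff estimate
   requires. *)
pose z : R := (2 * c) ^+ 4.
have z1 : 1 <= z by rewrite exprn_ege1 //; lra.
(* The first summand pays for [r + 2] values above the truncation level, the second for the Chernoff
   term; [z ^+ r.+2] pays for [y <= z]. *)
pose C2 : R := (16 * c) ^+ r.+2 + 1.
have C20 : 0 <= C2 by rewrite addr_ge0 // exprn_ge0 //; lra.
have zC0 : 0 < z ^+ r.+2 by rewrite exprn_gt0 //; lra.
exists (z ^+ r.+2 + C2); split; first exact: ltr_wpDr.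
move=> delta x n /andP[delta0 delta1] xe n0.
have x0 : 0 < x by exact: lt_le_trans (expR_gt0 1) xe.
have nR : 0 < n%:R :> R by rewrite ltr0n.
set y := delta * x; have y0 : 0 < y by exact: mulr_gt0.
have q0 : 0 < (1 - delta) * x by rewrite mulr_gt0 // subr_gt0.
rewrite -/e -[_ * _ * x `^ _]mulrA -powRM ?(ltW delta0) ?(ltW x0) // -/y.
have W0 : 0 <= y `^ (- e) by exact: powR_ge0.
have main0 : 0 <= 2 ^+ r.+1 / r.+1`!%:R * ((1 - delta) * x) ^- r.+1.
  by rewrite mulr_ge0 ?divr_ge0 ?invr_ge0 ?exprn_ge0 // ltW.
set a := a_rn r n _.
pose t := (1 - delta) * x * n%:R; pose s := n%:R * (a + y).
have -> : [set w | (trimmed_sum r [seq X i w | i <- iota 0 n] / n%:R - a > x)%R] =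
    [set w | s + t < trimmed_sum r [seq X i w | i <- iota 0 n]].
  apply/seteqP; split => w /=; rewrite ltrBrDr ltr_pdivlMr //;
    by rewrite (_ : (x + a) * n%:R = s + t) // /s /t /y; ring.
(* For [n <= r] both the trimmed sum and the centering vanish, so the event is empty. *)
case: (leqP n r) => [nr|rn].
  have a0 : a = 0 by rewrite /a /a_rn big_geq.
  rewrite (_ : [set w | _] = set0) ?measure0 ?lee_fin; last first.
    apply/seteqP; split => w //=; rewrite /trimmed_sum drop_oversize.
      rewrite big_nil ltNge => /negP; apply.
      by rewrite /s a0 add0r addr_ge0 // mulr_ge0 // ltW.
    by rewrite size_sort size_map size_iota.
  by rewrite addr_ge0 // mulr_ge0 // addr_ge0 // ltW.
have mX (i : nat) : measurable_fun setT (X i) by [].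
case: (leP y z) => [yz|zy].
  apply: (@le_trans _ _ 1%E).
    by apply: probability_le1; apply: (@measurable_trimmed_sum _ _ _ _ X).
  rewrite lee_fin [(_ + C2) * _]mulrDl.
  have := @one_le_powRN R r.+2 e y z z1 ec; rewrite y0 yz => /(_ isT).
  have := mulr_ge0 C20 W0; lra.
have y1 : 1 <= y by lra.
have [k [kt main]] := main_term_le r n0 q0.
pose u := Num.sqrt (Num.sqrt y).
have u4 : u ^+ 4 = y.
  by rewrite (exprM u 2 2) sqr_sqrtr ?sqrtr_ge0 // sqr_sqrtr // ltW.
have cu : 2 * c <= u.
  rewrite -(@ler_pXn2r _ 4) ?nnegrE ?sqrtr_ge0 //; last by lra.
  by rewrite u4 ltW.
(* [ML] serves the Chernoff bound; [MU] gives [n / 2 ^+ M <= 16 * c / y], which controls the number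
   of values above [2 ^+ M]. *)
have [M /andP[ML MU]] : exists M : nat,
    2 ^+ M <= n%:R * y / (8 * c) < 2 ^+ M.+1.
  apply: exists_dyadic_level; rewrite ler_pdivlMr ?mul1r; last by lra.
  have n1 : 1 <= n%:R :> R by rewrite ler1n.
  have : 8 * c <= z.
    rewrite /z (exprD _ 1 3) expr1 [leRHS]mulrC.
    have : 4 <= 2 * c by lra.
    have : 4 <= (2 * c) ^+ 3.
      by rewrite (exprD _ 1 2) expr1 expr2; nra.
    nra.
  by nra.
have p0 : (0 : R) < 2 ^+ M by exact: exprn_gt0.
have u1 : 1 <= u by lra.
have lam0 : 0 <= ln u / 2 ^+ M by rewrite divr_ge0 ?ln_ge0 // ltW.
have lamK : ln u / 2 ^+ M * 2 ^+ M = ln u by rewrite divfK ?gt_eqF.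
have t0 : 0 <= t by rewrite mulr_ge0 // ltW.
apply: le_trans (prob_trimmed_sum_le _ indX PX rn t0 kt lam0 lamK) _.
rewrite lee_fin -addrA; apply: lerD main _.
(* Both error terms are of order [y ^- r.+2], stronger than the exponent [r + 3 / 2] to be
   reached. *)
have yW : y ^- r.+2 <= y `^ (- e) by apply: powRN_exprn_le; case/andP: ec.
have aE : (up_log 2 n)%:R - 2 * c <= a.
  apply: le_trans (a_rn_ge R rn); rewrite lerD2l lerN2 ler_pM2l //.
  by rewrite /c ler_nat.
have := @truncated_chernoff_le R r.+2 n M _ a u n0 (@up_logP 2 n isT) isT cu aE.
rewrite u4 => /(_ ML) chern.
have big2 : 'C(n, r.+2)%:R * (2 ^- M) ^+ r.+2 <= (16 * c) ^+ r.+2 * y ^- r.+2.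
  apply: (@le_trans _ _ (n%:R ^+ r.+2 * (2 ^- M) ^+ r.+2)).
    rewrite ler_wpM2r ?exprn_ge0 ?invr_ge0 ?(ltW p0) //.
    apply: le_trans (bin_le_expn_div_fact R n r.+2) _.
    rewrite ler_pdivrMr ?ltr0n ?fact_gt0 // ler_peMr ?exprn_ge0 //.
    by rewrite ler1n fact_gt0.
  rewrite -[y ^- _]exprVn -!exprMn; apply: lerXn2r.
  - by rewrite nnegrE divr_ge0 // ltW.
  - by rewrite nnegrE divr_ge0 ?mulr_ge0 // ltW //; lra.
  rewrite ler_pdivrMr // mulrAC ler_pdivlMr //.
  by move: MU; rewrite ltr_pdivrMr ?exprS; lra.
have : (16 * c) ^+ r.+2 * y ^- r.+2 <= (16 * c) ^+ r.+2 * y `^ (- e).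
  by rewrite ler_wpM2l // exprn_ge0 //; lra.
have := mulr_ge0 (ltW zC0) W0.
by rewrite [(_ + C2) * _]mulrDl [C2 * _]mulrDl mul1r; lra.
Qed.
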